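(* Let $B$ be a Polish space. Then the following hold: (i) There exists a Urysohn field $\pi\colon U\to B$ over $B$. (ii) If $\pi\colon U\to B$ and $\pi'\colon U'\to B$ are Urysohn fields over $B$, then there exists a bijective isometry $\psi\colon U\to U'$ such that $\pi'\circ\psi=\pi$.
   Context: A Polish space means a complete separable metric space. A $B$-field is a $1$-Lipschitz map $\pi\colon X\to B$ where $X$ and $B$ are Polish spaces. A one-point metric extension of a metric space $A$ is a metric space $A^\ast=A\sqcup\{a^\ast\}$ whose metric restricts to the given one on $A$. A $B$-field $\pi\colon U\to B$ is a Urysohn field over $B$ if for each finite (possibly empty) subspace $A\subseteq U$ and each $1$-Lipschitz map $\phi\colon A^\ast\to B$ defined on a one-point metric extension $A^\ast=A\sqcup\{a^\ast\}$ and satisfying $\phi|_A=\pi|_A$, there exists an isometric embedding $\imath\colon A^\ast\to U$ such that $\imath|_A$ is the inclusion map and $\pi\circ\imath=\phi$. Isometric embeddings are distance-preserving maps, not necessarily surjective. *)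

(* Defs.v *)
From HB Require Import structures.
From mathcomp Require Import all_boot all_order all_algebra.
From mathcomp Require Import all_classical all_reals topology.

Set Implicit Arguments.
Unset Strict Implicit.
Unset Printing Implicit Defensive.

Import Order.TTheory GRing.Theory Num.Theory.

Local Open Scope classical_set_scope.
Local Open Scope ring_scope.

Section subset_metric.
Context {R : realType} {X : metricType R} (A : set X).

Let d (x y : A) : R := mdist (set_val x) (set_val y).

Let d_ge0 x y : 0 <= d x y. Proof. exact: mdist_ge0. Qed.

Let d_positivity x y : d x y = 0 -> x = y.
Proof. by move=> /mdist_positivity; exact: val_inj. Qed.

Let ballEd (x : A) e : ball x e = [set y | d x y < e].
Proof. by rewrite -[LHS]/(set_val @^-1` ball (set_val x) e) ballEmdist. Qed.

(* The library makes [set_type A] a pseudometric space, but not a metric one. *)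
HB.instance Definition _ :=
  PseudoMetric_isMetric.Build R (set_type A) d_ge0 d_positivity ballEd.

End subset_metric.

(* [completeType] is not used here because it forces the space to be inhabited:
   the empty space is a Polish space. *)
Definition polish {R : realType} (X : metricType R) : Prop :=
  (forall F : set_system X, ProperFilter F -> cauchy F -> exists x : X, F --> x) /\
  (exists2 S : set X, countable S & dense S).

(* The library's [k.-lipschitz] requires normed modules. *)
Definition one_lipschitz {R : realType} {X Y : metricType R}
    (f : X -> Y) : Prop :=
  forall x y, mdist (f x) (f y) <= mdist x y.

Definition isometric_embedding {R : realType} {X Y : metricType R}
    (f : X -> Y) : Prop :=
  forall x y, mdist (f x) (f y) = mdist x y.

Definition polish_field {R : realType} {X B : metricType R}
    (pi : X -> B) : Prop :=
  [/\ polish X, polish B & one_lipschitz pi].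

(* E is the disjoint union of (the isometric copy j(A) of) A and {s}. *)
Definition one_point_extension {R : realType} {A E : metricType R}
    (j : A -> E) (s : E) : Prop :=
  isometric_embedding j /\ ~` range j = [set s].

Definition urysohn_field {R : realType} {U B : metricType R}
    (pi : U -> B) : Prop :=
  polish_field pi /\
  forall A : set U, finite_set A ->
  forall (E : metricType R) (j : set_type A -> E) (s : E),
    one_point_extension j s ->
  forall phi : E -> B, one_lipschitz phi ->
    phi \o j =1 pi \o set_val ->
  exists i : E -> U,
    [/\ isometric_embedding i, i \o j =1 set_val & pi \o i =1 phi].

(* Main.v *)
From HB Require Import structures.
Require Import Defs.
From mathcomp Require Import all_boot all_order all_algebra.
From mathcomp Require Import all_classical all_reals topology.
From mathcomp Require Import interval_inference normedtype lra.

(** Uniqueness is a back-and-forth argument. The Urysohn property, applied to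
    a finite subset of U' and to the trace on U of a finite partial isometry
    over B together with one more point of U, extends that partial isometry by
    the point ([matched_extend]); by symmetry it also extends to a given point
    of U'. Alternating along countable dense sets gives a partial isometry with
    dense domain and dense range ([back_and_forth]), and by completeness of
    both spaces its closure is the graph of an isometry of U onto U' over B
    ([matched_isometry]).

    Existence: the field is the completion of a pseudometric on nat, built one
    point at a time. Before the construction starts, every n is given a point
    of a countable dense subset of B, its image, and a finite list of pairs
    (j, q), read as the request that n be at distance about q from j. When the
    request is compatible with the distances among the points below n and with
    the images in B, the point n is glued to its predecessors by
    d(n, i) = min_(j, q) (q + d(j, i)), the largest distances bounded by the
    request; this keeps the triangle inequality and the Lipschitz
    condition over B ([amalgamation_distances]). Requests have rational
    distances, and each of them is made infinitely often, so that every
    one-point extension problem over the completion is solved up to any error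
    ([completion_approximate_extension]).

    Approximate solutions suffice: a solution u with error 2^-k becomes,
    together with the distance 2^-k from u, part of the next problem. The next
    solution is then close to u and has a smaller error, and the limit of the
    resulting Cauchy sequence solves the problem exactly
    ([exact_extension_nonempty]). *)

Set Implicit Arguments.
Unset Strict Implicit.
Unset Printing Implicit Defensive.

Import Order.TTheory GRing.Theory Num.Theory.
Import metricType_numDomainType.

Local Open Scope classical_set_scope.
Local Open Scope ring_scope.

(** * Choice, completeness and density in metric spaces *)

(** Dependent choice along nat, with an invariant that may depend on the
    step. *)
Lemma sequential_choice (T : Type) (P : nat -> T -> Prop)
    (Q : nat -> T -> T -> Prop) :
  (exists t, P 0%N t) ->
  (forall n t, P n t -> exists2 t', P n.+1 t' & Q n t t') ->
  exists f : nat -> T, forall n, P n (f n) /\ Q n (f n) (f n.+1).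
Proof.
move=> [t0 Pt0] step; pose X := {p : nat * T | P p.1 p.2}.
pose rel (a b : X) :=
  (sval b).1 = (sval a).1.+1 /\ Q (sval a).1 (sval a).2 (sval b).2.
have rel_total (a : X) : {b | rel a b}.
  apply: cid; case: a => -[n t] /= Pt; have [t' Pt' Qt] := step n t Pt.
  by exists (exist _ (n.+1, t') Pt').
have [f [f0 relf]] := dependent_choice rel_total (exist _ (0%N, t0) Pt0).
have fn n : (sval (f n)).1 = n.
  by elim: n => [|n IHn]; [rewrite f0 | have [-> _] := relf n; rewrite IHn].
exists (fun n => (sval (f n)).2) => n; split.
  by have := svalP (f n); rewrite fn.
by have [_] := relf n; rewrite fn.
Qed.

Section metric_tools.
Context {R : realType}.
Implicit Types X : metricType R.

Definition complete_space X : Prop :=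
  forall F : set_system X, ProperFilter F -> cauchy F -> exists x : X, F --> x.

Lemma halfpow_gt0 k : 0 < 2^-1 ^+ k :> R.
Proof. by rewrite exprn_gt0 // invr_gt0 ltr0n. Qed.

Lemma halfpow_small (e : R) : 0 < e -> exists k : nat, 2^-1 ^+ k < e.
Proof.
move=> e0; have [k _ /(_ k (leqnn k))] := near_infty_natSinv_expn_lt (PosNum e0).
by rewrite /= div1r -exprVn => ke; exists k.
Qed.

Lemma cauchy_mdistP X (F : set_system X) : Filter F ->
  cauchy F <-> forall e : R, 0 < e ->
    exists2 A, F A & forall x y, A x -> A y -> mdist x y <= e.
Proof.
move=> FF; rewrite -cauchy_ballP; split=> cF e e0.
  have [[A1 A2] /= [FA1 FA2] A12] := cF e e0.
  exists (A1 `&` A2); first exact: filterI.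
  move=> x y [A1x _] [_ A2y]; have := A12 (x, y) (conj A1x A2y).
  by rewrite /= ballEmdist => /ltW.
have [|A FA Ae] := cF (e / 2); first by rewrite divr_gt0.
exists (A, A) => // -[x y] [/= Ax Ay]; rewrite ballEmdist /=.
by apply: le_lt_trans (Ae _ _ Ax Ay) _; lra.
Qed.

(** The constants are those of a geometric series: if each step is at most
    [2 * 2^-k], the tail after [k] has length at most [4 * 2^-k]. *)
Lemma complete_space_halfpow X (u : nat -> X) : complete_space X ->
  (forall k, mdist (u k) (u k.+1) <= 2 * 2^-1 ^+ k) ->
  exists x, forall k, mdist (u k) x <= 4 * 2^-1 ^+ k.
Proof.
move=> cX uS.
(* The second summand makes the bound inductive: it is the part of the series
   that is still to come. *)
have um k m : mdist (u k) (u (k + m)%N) + 4 * 2^-1 ^+ (k + m) <= 4 * 2^-1 ^+ k.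
  elim: m => [|m IHm]; first by rewrite addn0 mdistxx add0r.
  have := uS (k + m)%N.
  have := metric_triangle (u k) (u (k + m)%N) (u (k + m).+1).
  by rewrite addnS exprS; lra.
have ule k m : (k <= m)%N -> mdist (u k) (u m) <= 4 * 2^-1 ^+ k.
  move=> km; have := um k (m - k)%N; rewrite subnKC //.
  by have := halfpow_gt0 m; lra.
have cu : cauchy (u @ \oo).
  apply/cauchy_mdistP => e e0; have [|k ke] := @halfpow_small (e / 8).
    by rewrite divr_gt0.
  exists [set x | mdist (u k) x <= 4 * 2^-1 ^+ k].
    by exists k => // m /= km; exact: ule.
  move=> x y /= ux uy; have := metric_triangle x (u k) y.
  by rewrite (metric_sym x (u k)); lra.
have [x /(cvgrPdist_lt (V := X) _ _) ux] := cX _ _ cu.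
exists x => k; apply/ler_addgt0Pr => e /ux [m _ mP].
have := mP (maxn m k) (leq_maxl _ _); have := ule k _ (leq_maxr m k).
have := metric_triangle (u k) (u (maxn m k)) x.
by rewrite (metric_sym x (u _)); lra.
Qed.

Lemma dense_near X (S : set X) (x : X) (e : R) : dense S -> 0 < e ->
  exists2 y, S y & mdist x y < e.
Proof.
move=> dS e0; have xe : nbhs x (ball x e) by exact: nbhsx_ballx.
have [||y [yB Sy]] := dS (ball x e)^°.
- by exists x; exact: nbhs_singleton (nbhs_interior xe).
- exact: open_interior.
by exists y => //; have := interior_subset yB; rewrite ballEmdist.
Qed.

Lemma mdist_eq0 X (x y : X) : (forall e : R, 0 < e -> mdist x y <= e) -> x = y.
Proof.
move=> xy; apply: mdist_positivity; apply/eqP; rewrite eq_le mdist_ge0 andbT.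
by apply/ler_addgt0Pr => e /xy; rewrite add0r.
Qed.

End metric_tools.

(** * Uniqueness by back and forth *)

Section matched.
Context {R : realType} {B : metricType R}.

(** A partial isometry over [B], given by its graph; as a relation it has the
    two sides on the same footing, so that back and forth are one argument. *)
Definition matched {U U' : metricType R} (pi : U -> B) (pi' : U' -> B)
    (G : set (U * U')) : Prop :=
  (forall x x', G (x, x') -> pi x = pi' x') /\
  (forall x x' y y', G (x, x') -> G (y, y') -> mdist x y = mdist x' y').

Definition converse {T T' : Type} (G : set (T * T')) : set (T' * T) :=
  [set p | G (p.2, p.1)].

Lemma matched_converse (U U' : metricType R) (pi : U -> B) (pi' : U' -> B) G :
  matched pi pi' G -> matched pi' pi (converse G).
Proof.
move=> [Gpi Gd]; split=> [x' x /Gpi //|x' x y' y Gx Gy].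
by apply/esym; exact: Gd Gx Gy.
Qed.

Lemma finite_converse (T T' : Type) (G : set (T * T')) :
  finite_set G -> finite_set (converse G).
Proof.
move=> fG; suff -> : converse G = (fun p => (p.2, p.1)) @` G.
  exact: finite_image.
apply/seteqP; split => [[x' x] /= Gx|_ [[x x'] Gx <-] //].
by exists (x, x').
Qed.

(** The one-point extension to which the Urysohn property is applied lives
    inside [U]: it is the domain of [G] with [x] added, a metric subspace,
    and [j] is the inverse of the partial isometry. *)
Lemma matched_extend (U U' : metricType R) (pi : U -> B) (pi' : U' -> B) G x :
  one_lipschitz pi -> urysohn_field pi' -> finite_set G -> matched pi pi' G ->
  exists x', matched pi pi' (G `|` [set (x, x')]).
Proof.
move=> lip_pi [_ ury] fG mG; have [Gpi Gd] := mG.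
have [[x' Gx]|xG] := pselect (exists x', G (x, x')).
  by exists x'; rewrite setUidl // => _ ->.
pose A := [set y' | exists y, G (y, y')].
have fA : finite_set A.
  suff -> : A = snd @` G by exact: finite_image.
  by apply/seteqP; split => [y' [y Gy]|_ [[y y'] Gy <-]]; [exists (y, y')|exists y].
pose E := [set y | (exists y', G (y, y')) \/ y = x].
have jP (a : A) : {y : E | G (val y, val a)}.
  apply: cid; have [y Gy] := set_mem (valP a).
  by exists (SigSub (mem_set (or_introl (ex_intro _ _ Gy) : E y))).
pose j a := sval (jP a).
have jG a : G (val (j a), val a) := svalP (jP a).
pose s : E := SigSub (mem_set (or_intror erefl : E x)).
have ext : one_point_extension j s.
  split=> [a b|]; first exact: Gd (jG a) (jG b).
  apply/seteqP; split=> [[y yE] yj /=|_ -> [a _ jas]].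
    apply: val_inj => /=; have [[y' Gy]|//] := set_mem yE.
    case: yj; exists (SigSub (mem_set (ex_intro _ _ Gy : A y'))) => //.
    apply: val_inj; apply: mdist_positivity.
    by rewrite (Gd _ _ _ _ (jG _) Gy) mdistxx.
  by apply: xG; exists (val a); have := jG a; rewrite jas.
have [|a|i [iso_i ij pii]] := ury A fA E j s ext (pi \o val).
- by move=> y z; exact: lip_pi.
- exact: Gpi (jG a).
(* The image of the added point under the embedding is the partner of x. *)
exists (i s); split=> [y y' [Gy|[-> ->]]|].
- exact: Gpi.
- by rewrite -[pi' _]/((pi' \o i) s) pii.
have key y y' : G (y, y') -> mdist y x = mdist y' (i s).
  move=> Gy; pose a : A := SigSub (mem_set (ex_intro _ _ Gy : A y')).
  have <- : i (j a) = y' by rewrite -[LHS]/((i \o j) a) ij.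
  rewrite iso_i; suff <- : val (j a) = y by [].
  by apply: mdist_positivity; rewrite (Gd _ _ _ _ (jG a) Gy) mdistxx.
move=> y y' z z' [Gy|[-> ->]] [Gz|[-> ->]].
- exact: Gd.
- exact: key.
- by rewrite metric_sym (metric_sym (i s)); exact: key.
- by rewrite !mdistxx.
Qed.

Lemma matched_extend_converse (U U' : metricType R) (pi : U -> B) (pi' : U' -> B) G x :
  one_lipschitz pi' -> urysohn_field pi -> finite_set G -> matched pi pi' G ->
  exists x', matched pi pi' (G `|` [set (x', x)]).
Proof.
move=> lip_pi' ury fG mG.
have [x'] := matched_extend x lip_pi' ury (finite_converse fG) (matched_converse mG).
move=> /matched_converse mG'; exists x'; congr (matched pi pi' _): mG'.
by apply/seteqP; split=> -[y y'] [Gy|[-> ->]]; [left|right|left|right].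
Qed.

Lemma subset_chain T (P : nat -> set T) : (forall n, P n `<=` P n.+1) ->
  forall n m, (n <= m)%N -> P n `<=` P m.
Proof.
move=> PS n m /subnKC <-; elim: (m - n)%N => [|k IHk]; first by rewrite addn0.
by rewrite addnS; exact: subset_trans IHk (PS _).
Qed.

(** The countable sets are enumerated through injections [f], [f'] into nat:
    step [n] takes care of the at most one point of each set with number [n].
    This also covers empty spaces. *)
Lemma back_and_forth (U U' : metricType R) (pi : U -> B) (pi' : U' -> B)
    (S : set U) (S' : set U') :
  urysohn_field pi -> urysohn_field pi' -> countable S -> countable S' ->
  exists G, [/\ matched pi pi' G, (forall x, S x -> exists x', G (x, x'))
              & (forall x', S' x' -> exists x, G (x, x'))].
Proof.
move=> ury ury' /countable_injP[f injf] /countable_injP[f' injf'].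
have [[_ _ lip] _] := ury; have [[_ _ lip'] _] := ury'.
have [|n G [fG mG]|G GP] := sequential_choice
    (P := fun n G => finite_set G /\ matched pi pi' G)
    (Q := fun n G G' => [/\ G `<=` G',
       (forall x, S x -> f x = n -> exists x', G' (x, x')) &
       (forall x', S' x' -> f' x' = n -> exists x, G' (x, x'))]).
- by exists set0; split=> //; split.
- have [G1 [fG1 mG1 GG1 SG1]] : exists G1, [/\ finite_set G1, matched pi pi' G1,
      G `<=` G1 & forall x, S x -> f x = n -> exists x', G1 (x, x')].
    have [[x Sx fx]|noS] := pselect (exists2 x, S x & f x = n); last first.
      by exists G; split=> // x Sx fx; case: noS; exists x.
    have [x' mGx] := matched_extend x lip ury' fG mG.
    exists (G `|` [set (x, x')]); split=> //; first by rewrite finite_setU.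
    move=> y Sy fy; exists x'; right; congr (_, _).
    by apply: injf; rewrite ?inE // fy.
  have [[x Sx fx]|noS] := pselect (exists2 x, S' x & f' x = n); last first.
    by exists G1; split=> // x Sx fx; case: noS; exists x.
  have [x' mGx] := matched_extend_converse x lip' ury fG1 mG1.
  exists (G1 `|` [set (x', x)]); first by split=> //; rewrite finite_setU.
  split; first by move=> p /GG1; left.
    by move=> y Sy fy; have [y' Gy] := SG1 y Sy fy; exists y'; left.
  move=> y Sy fy; exists x'; right; congr (_, _).
  by apply: injf'; rewrite ?inE // fy.
have Gmono := subset_chain (fun n => let: And3 H _ _ := (GP n).2 in H).
exists (\bigcup_n G n); split.
- split=> [x x' [n _ Gx]|x x' y y' [n _ Gx] [m _ Gy]].
    exact: (GP n).1.2.1 Gx.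
  apply: (GP (maxn n m)).1.2.2.
    exact: Gmono (leq_maxl _ _) _ Gx.
  exact: Gmono (leq_maxr _ _) _ Gy.
- move=> x Sx; have [_ /(_ x Sx erefl)[x' Gx] _] := (GP (f x)).2.
  by exists x', (f x).+1.
- move=> x Sx; have [_ _ /(_ x Sx erefl)[x' Gx]] := (GP (f' x)).2.
  by exists x', (f' x).+1.
Qed.

(** If [G] is a partial isometry with dense domain and range, this relation is
    the closure of [G]: a point is determined by its distances to a dense set. *)
Definition same_distances {U U' : metricType R} (G : set (U * U')) (u : U) (u' : U') :=
  forall x x', G (x, x') -> mdist x u = mdist x' u'.

(** Points of the domain of [G] converging to [u] have partners that form a
    Cauchy sequence, as [G] preserves distances; its limit is [u']. *)
Lemma same_distances_total (U U' : metricType R) (pi : U -> B) (pi' : U' -> B)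
    (S : set U) G : complete_space U' -> dense S ->
  matched pi pi' G -> (forall x, S x -> exists x', G (x, x')) ->
  forall u, exists u', same_distances G u u'.
Proof.
move=> cU' dS [_ Gd] SG u.
have [p pP] : {p : nat -> U * U' & forall k, G (p k) /\ mdist u (p k).1 < 2^-1 ^+ k}.
  apply: (@choice _ _ (fun k q => G q /\ mdist u q.1 < 2^-1 ^+ k)) => k.
  have [y Sy yu] := dense_near u dS (halfpow_gt0 k).
  by have [y' Gy] := SG y Sy; exists (y, y').
have Gp k : G ((p k).1, (p k).2) by rewrite -surjective_pairing; case: (pP k).
have [k|u' u'P] := complete_space_halfpow (u := fun k => (p k).2) cU'.
  rewrite -(Gd _ _ _ _ (Gp k) (Gp k.+1)).
  have := metric_triangle (p k).1 u (p k.+1).1.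
  rewrite (metric_sym (p k).1 u).
  have [_ uk] := pP k; have [_ uk1] := pP k.+1.
  have := halfpow_gt0 (R := R) k.
  by rewrite exprS in uk1; lra.
exists u' => x x' Gx; apply/eqP; rewrite eq_le.
by apply/andP; split; apply/ler_addgt0Pr => e e0;
  have [|k ke] := @halfpow_small _ (e / 5); rewrite ?divr_gt0 //;
  have [_ uk] := pP k; have u'k := u'P k; have := Gd _ _ _ _ Gx (Gp k);
  have := metric_triangle x (p k).1 u; have := metric_triangle x u (p k).1;
  have := metric_triangle x' (p k).2 u'; have := metric_triangle x' u' (p k).2;
  rewrite (metric_sym (p k).1 u) (metric_sym u' (p k).2); lra.
Qed.

(** Both distances are approximated by [mdist x v = mdist x' v'], where [x]
    close to [u] has partner [x']. *)
Lemma same_distances_isometric (U U' : metricType R) (pi : U -> B) (pi' : U' -> B)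
    (S : set U) G : dense S ->
  matched pi pi' G -> (forall x, S x -> exists x', G (x, x')) ->
  forall u u' v v', same_distances G u u' -> same_distances G v v' ->
  mdist u v = mdist u' v'.
Proof.
move=> dS [_ Gd] SG u u' v v' uu vv; apply/eqP; rewrite eq_le.
apply/andP; split; apply/ler_addgt0Pr => e e0;
  have [|x Sx ux] := @dense_near _ _ S u (e / 2) dS; rewrite ?divr_gt0 //;
  have [x' Gx] := SG x Sx; have := uu _ _ Gx; have := vv _ _ Gx;
  have := metric_triangle u x v; have := metric_triangle x u v;
  have := metric_triangle u' x' v'; have := metric_triangle x' u' v';
  rewrite (metric_sym u x) in ux *; rewrite ?(metric_sym u' x'); lra.
Qed.

Lemma matched_isometry (U U' : metricType R) (pi : U -> B) (pi' : U' -> B)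
    (S : set U) (S' : set U') G :
  complete_space U -> complete_space U' -> dense S -> dense S' ->
  one_lipschitz pi -> one_lipschitz pi' -> matched pi pi' G ->
  (forall x, S x -> exists x', G (x, x')) ->
  (forall x', S' x' -> exists x, G (x, x')) ->
  exists psi : U -> U',
    [/\ bijective psi, isometric_embedding psi & pi' \o psi =1 pi].
Proof.
move=> cU cU' dS dS' lip lip' mG SG S'G.
have [psi psiP] := choice (same_distances_total cU' dS mG SG).
have [phi phiP] :=
  choice (same_distances_total cU dS' (matched_converse mG) S'G).
have iso := same_distances_isometric dS mG SG.
have phiP' u' : same_distances G (phi u') u'.
  by move=> x x' Gx; apply/esym; exact: phiP.
exists psi; split.
- exists phi => [u|u']; apply: mdist_positivity.
    by rewrite (iso _ _ _ _ (phiP' _) (psiP u)) mdistxx.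
  by rewrite -(iso _ _ _ _ (psiP _) (phiP' u')) mdistxx.
- by move=> u v; rewrite (iso _ _ _ _ (psiP u) (psiP v)).
- move=> u; apply: mdist_eq0 => e e0 /=.
  have [|x Sx ux] := @dense_near _ _ S u (e / 2) dS; first by rewrite divr_gt0.
  have [x' Gx] := SG x Sx; have := psiP u _ _ Gx.
  have := lip x u; have := lip' x' (psi u).
  have := metric_triangle (pi' (psi u)) (pi' x') (pi u); rewrite -{2}(mG.1 _ _ Gx).
  rewrite (metric_sym (pi' (psi u)) (pi' x')) (metric_sym u x) in ux *; lra.
Qed.

Lemma urysohn_field_unique (U U' : metricType R) (pi : U -> B) (pi' : U' -> B) :
  urysohn_field pi -> urysohn_field pi' ->
  exists psi : U -> U',
    [/\ bijective psi, isometric_embedding psi & pi' \o psi =1 pi].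
Proof.
move=> ury ury'.
have [[[cU [S cS dS]] _ lip] _] := ury.
have [[[cU' [S' cS' dS']] _ lip'] _] := ury'.
have [G [mG SG S'G]] := back_and_forth ury ury' cS cS'.
exact: matched_isometry cU cU' dS dS' lip lip' mG SG S'G.
Qed.

End matched.

(** * A pseudometric on nat with prescribed one-point extensions *)

Section amalgamation.
Context {R : realType} {B : metricType R} (p : nat -> B).
Implicit Types (d : nat -> nat -> R) (L : seq (nat * R)).

Lemma seq_min (T : eqType) (F : T -> R) (s : seq T) : s != [::] ->
  exists m, (forall x, x \in s -> m <= F x) /\ exists2 x, x \in s & m = F x.
Proof.
elim: s => // x [|y s] IHs _.
  by exists (F x); split=> [z|]; [rewrite inE => /eqP -> | exists x; rewrite ?inE].
have [m [mle [z zs mE]]] := IHs isT.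
exists (Num.min (F x) m); split=> [t|].
  by rewrite inE => /orP[/eqP ->|/mle tm]; rewrite ge_min ?lexx ?tm ?orbT.
have [xm|mx] := leP (F x) m; [exists x | exists z] => //; rewrite inE ?eqxx //.
by rewrite zs orbT.
Qed.

(** [d] makes the numbers below [n] a pseudometric space on which [p] is
    1-Lipschitz. Bounding the indices lets the distances be built one point at
    a time. *)
Definition field_below n d : Prop :=
  [/\ forall i, (i < n)%N -> d i i = 0,
      forall i j, (i < n)%N -> (j < n)%N -> d i j = d j i,
      forall i j k, (i < n)%N -> (j < n)%N -> (k < n)%N ->
        d i k <= d i j + d j k
    & forall i j, (i < n)%N -> (j < n)%N -> mdist (p i) (p j) <= d i j].

(** The constraints that distances [c.2] from a new point over [b] to the
    points [c.1] must satisfy as upper bounds. The remaining triangle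
    inequality, that [c.2] varies by at most [d], is left out: the gluing by
    minima restores it, and it would not survive the rounding to rationals. *)
Definition admissible n d b L : Prop :=
  [/\ L != [::], forall c, c \in L -> (c.1 < n)%N,
      forall c c', c \in L -> c' \in L -> d c.1 c'.1 <= c.2 + c'.2
    & forall c, c \in L -> mdist (p c.1) b <= c.2].

(** [g i] is the minimum of [c.2 + d c.1 i] over [c] in [L], the distance
    from the new point to [i] along the shortest path through [L]. *)
Definition realizes n d (g : nat -> R) L : Prop :=
  forall i, (i < n)%N ->
    (forall c, c \in L -> g i <= c.2 + d c.1 i) /\
    (exists2 c, c \in L & g i = c.2 + d c.1 i).

(** A shortest path to [j] prolonged to [i] bounds [g i]. Two shortest paths,
    to [i] and to [j], together dominate [d i j] because admissibility says so
    for their starting points; likewise each one dominates the distance from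
    its end point to the new point in [B]. *)
Lemma amalgamation_distances n d b L : field_below n d -> admissible n d b L ->
  exists2 g, realizes n d g L & forall i j, (i < n)%N -> (j < n)%N ->
    [/\ g i <= g j + d j i, d i j <= g i + g j & mdist (p i) b <= g i].
Proof.
move=> [d0 dC dT dB] [L0 Ln LL Lb].
have [g gP] := choice (fun i => seq_min (fun c => c.2 + d c.1 i) L0).
exists g => [i _|i j ltin ltjn]; first exact: gP.
have [gi [c cL giE]] := gP i; have [gj [c' c'L gjE]] := gP j.
have [ltc ltc'] := (Ln c cL, Ln c' c'L); split.
- by have := gi c' c'L; have := dT c'.1 j i ltc' ltjn ltin; lra.
- have := LL c c' cL c'L; have := dT i c.1 j ltin ltc ltjn.
  have := dT c.1 c'.1 j ltc ltc' ltjn; rewrite (dC i c.1) //; lra.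
- have := Lb c cL; have := dB c.1 i ltc ltin.
  have := metric_triangle (p i) (p c.1) b; rewrite (metric_sym (p i) (p c.1)); lra.
Qed.

Lemma field_below_extend n d L : field_below n d ->
  exists2 d', field_below n.+1 d' &
    (forall i j, (i < n)%N -> (j < n)%N -> d' i j = d i j) /\
    (admissible n d (p n) L -> realizes n d (d' n) L).
Proof.
move=> fd; have [d0 dC dT dB] := fd.
have [g gL gP] : exists2 g, (admissible n d (p n) L -> realizes n d g L) &
    forall i j, (i < n)%N -> (j < n)%N ->
    [/\ g i <= g j + d j i, d i j <= g i + g j & mdist (p i) (p n) <= g i].
  have [aL|naL] := pselect (admissible n d (p n) L).
    by have [g gL gP] := amalgamation_distances fd aL; exists g.
  case: (posnP n) => [n0|n_gt0].
    by exists (fun=> 0) => // i j; rewrite n0.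
  (* An impossible request is replaced by a harmless one: distance to the point
     0 equal to the distance of the images. *)
  have [|g _ gP] := @amalgamation_distances n d (p n)
      [:: (0%N, mdist (p 0%N) (p n))] fd; last by exists g.
  split=> // [c|c c'|c]; rewrite !inE => /eqP -> //= /eqP ->.
  by rewrite d0 // addr_ge0 // mdist_ge0.
pose d' i j := if i == n then if j == n then 0 else g j
               else if j == n then g i else d i j.
have ltn_eqn i : (i < n)%N -> (i == n) = false by move=> /ltn_eqF.
have d'E i j : (i < n)%N -> (j < n)%N -> d' i j = d i j.
  by move=> ? ?; rewrite /d' !ltn_eqn.
have d'n i : (i < n)%N -> d' n i = g i by move=> ?; rewrite /d' eqxx ltn_eqn.
exists d'; last first.
  split=> // aL i ltin; rewrite d'n //; exact: gL.
have ltSE i : (i < n.+1)%N -> i = n \/ (i < n)%N.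
  by rewrite ltnS leq_eqVlt => /orP[/eqP|]; [left|right].
have g0 i : (i < n)%N -> 0 <= g i.
  by move=> ltin; have [_ _] := gP i i ltin ltin; apply: le_trans; exact: mdist_ge0.
rewrite /d'; split.
- by move=> i /ltSE[->|ltin]; rewrite ?eqxx // ltn_eqn // d0.
- by move=> i j /ltSE[->|ltin] /ltSE[->|ltjn]; rewrite ?eqxx ?ltn_eqn // dC.
- move=> i j k /ltSE[->|ltin] /ltSE[->|ltjn] /ltSE[->|ltkn];
    rewrite ?eqxx ?ltn_eqn //; rewrite ?add0r ?addr0 ?lexx ?addr_ge0 ?g0 //.
  + by have [] := gP k j ltkn ltjn.
  + by have [_] := gP i k ltin ltkn.
  + by have [] := gP i j ltin ltjn; rewrite dC // addrC.
  + exact: dT.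
- move=> i j /ltSE[->|ltin] /ltSE[->|ltjn]; rewrite ?eqxx ?ltn_eqn ?mdistxx //.
  + by rewrite metric_sym; have [] := gP j j ltjn ltjn.
  + by have [] := gP i i ltin ltin.
  + exact: dB.
Qed.

Lemma amalgamation_sequence (request : nat -> seq (nat * R)) :
  exists d, (forall n, field_below n d) /\
    forall n, admissible n d (p n) (request n) -> realizes n d (d n) (request n).
Proof.
have [|n d fd|f fP] := sequential_choice (P := field_below)
    (Q := fun n d d' =>
       (forall i j, (i < n)%N -> (j < n)%N -> d' i j = d i j) /\
       (admissible n d (p n) (request n) -> realizes n d (d' n) (request n))).
- by exists (fun _ _ => 0); split.
- exact: field_below_extend.
have fE n m i j : (n <= m)%N -> (i < n)%N -> (j < n)%N -> f m i j = f n i j.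
  move=> /subnKC <- ltin ltjn; elim: (m - n)%N => [|k IHk]; first by rewrite addn0.
  have [_ [fS _]] := fP (n + k)%N.
  by rewrite addnS fS ?IHk // ltn_addr.
pose d i j := f (maxn i j).+1 i j.
have dE n i j : (i < n)%N -> (j < n)%N -> d i j = f n i j.
  by move=> ltin ltjn; rewrite /d -(@fE (maxn i j).+1 n) ?ltnS ?leq_maxl ?leq_maxr //
    gtn_max ltin.
(* The n-th stage agrees with d below n only, while n.+1 is the stage at which
   the distances from n are decided. *)
exists d; split=> n.
  have [[d0 dC dT dB] _] := fP n; split.
  - by move=> i ltin; rewrite (dE n) // d0.
  - by move=> i j ltin ltjn; rewrite !(dE n) // dC.
  - by move=> i j k ltin ltjn ltkn; rewrite !(dE n) // dT.
  - by move=> i j ltin ltjn; rewrite (dE n) // dB.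
move=> [L0 Ln LL Lb]; have [_ [_ fR]] := fP n.
have /fR {}fR : admissible n (f n) (p n) (request n).
  by split=> // c c' cL c'L; rewrite -dE ?Ln // LL.
move=> i ltin; have [fle [c cL fc]] := fR i ltin.
rewrite (dE n.+1) ?ltnS ?(ltnW ltin) //.
split=> [c' c'L|]; first by rewrite (dE n) ?Ln // fle.
by exists c => //; rewrite (dE n) ?Ln.
Qed.

End amalgamation.

(** * The completion of a pseudometric on nat, over B *)

Section completeness_tools.
Context {R : realType}.

Lemma complete_line : complete_space (R^o : metricType R).
Proof. by move=> F FF cF; apply/cvg_ex; exact: R_complete FF cF. Qed.

(** The limit of [f] along [F], with a rate of convergence that does not
    depend on [f] or [Y]: a bound on the diameter of a set in [F]. *)
Lemma cauchy_image_limit (X Y : metricType R) (f : X -> Y) (F : set_system X) :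
  ProperFilter F -> complete_space Y -> one_lipschitz f -> cauchy F ->
  exists y, forall A e, F A -> (forall x x', A x -> A x' -> mdist x x' <= e) ->
    forall x, A x -> mdist (f x) y <= e.
Proof.
move=> FF cY lip cF; have cfF : cauchy (f @ F).
  apply/cauchy_mdistP => e e0; have [A FA Ae] := (cauchy_mdistP _).1 cF e e0.
  exists (f @` A); first by apply: (@filterS _ F _ A) FA => x Ax; exists x.
  move=> _ _ [x Ax <-] [x' Ax' <-].
  exact: le_trans (lip _ _) (Ae _ _ Ax Ax').
have [y /(cvgrPdist_lt (V := Y) _ _) fy] := cY _ (fmap_proper_filter f FF) cfF.
exists y => A e FA Ae x Ax.
apply/ler_addgt0Pr => a a0.
have [x' [Ax' fx']] := filter_ex (filterI FA (fy a a0)).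
have := metric_triangle (f x) (f x') y; have := lip x x'; have := Ae _ _ Ax Ax'.
by rewrite (metric_sym (f x') y); lra.
Qed.

End completeness_tools.

Section completion.
Context {R : realType} {B : metricType R} (p : nat -> B) (d : nat -> nat -> R).
Hypothesis dP : forall n, field_below p n d.

(** A point of the completion is coded by its distances to the points of nat
    and its image in [B]. The codes are the uniform limits of those of the
    points of nat. *)
Definition limit_of_points (f : (nat -> R) * B) : Prop :=
  forall e, 0 < e ->
    exists n, (forall i, `|f.1 i - d n i| <= e) /\ mdist f.2 (p n) <= e.

(** The proof argument is what allows the metric structure below, which
    depends on it, to be inferred from the type. *)
Definition completion of (forall n, field_below p n d) : Type :=
  {f : (nat -> R) * B | `[< limit_of_points f >]}.

Local Notation U := (completion dP).
Implicit Types f g h : U.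

HB.instance Definition _ := Choice.on U.

Let dist f g : R := sup (range (fun i => `|(val f).1 i - (val g).1 i|)).

Let d0 i : d i i = 0.
Proof. by have [d0 _ _ _] := dP i.+1; rewrite d0. Qed.

Let dC i j : d i j = d j i.
Proof.
have [_ dC _ _] := dP (maxn i j).+1.
by rewrite dC // ltnS ?leq_maxl ?leq_maxr.
Qed.

Let dT i j k : d i k <= d i j + d j k.
Proof.
have [_ _ dT _] := dP (maxn i (maxn j k)).+1.
by rewrite dT // ltnS !leq_max leqnn ?orbT.
Qed.

Let dB i j : mdist (p i) (p j) <= d i j.
Proof.
have [_ _ _ dB] := dP (maxn i j).+1.
by rewrite dB // ltnS ?leq_maxl ?leq_maxr.
Qed.

Lemma near_point f e : 0 < e ->
  exists n, (forall i, `|(val f).1 i - d n i| <= e) /\ mdist (val f).2 (p n) <= e.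
Proof. by move=> e0; have /asboolP := valP f; exact. Qed.

Let dist_ub f g : has_ubound (range (fun i => `|(val f).1 i - (val g).1 i|)).
Proof.
have [n [fn _]] := near_point f ltr01; have [m [gm _]] := near_point g ltr01.
exists (2 + d n m) => _ [i _ <-]; move: (fn i) (gm i).
rewrite !ler_distl => /andP[? ?] /andP[? ?].
have := dT n m i; have := dT m n i; rewrite (dC m n).
by move=> ? ?; apply/andP; split; lra.
Qed.

Let le_dist f g i : `|(val f).1 i - (val g).1 i| <= dist f g.
Proof. by apply: ub_le_sup; [exact: dist_ub | exists i]. Qed.

Let dist_le f g c : (forall i, `|(val f).1 i - (val g).1 i| <= c) -> dist f g <= c.
Proof.
move=> fgc; apply: ge_sup => [|_ [i _ <-] //].
by exists `|(val f).1 0%N - (val g).1 0%N|, 0%N.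
Qed.

(** Near a point [m] of nat that approximates [g], the [m]-th coordinate of
    [g] is small and that of [f] is nearly the distance from [f] to [g], which
    dominates the distance of the images because [p] is 1-Lipschitz. This is
    why the sup distance of the first components is a metric on the pairs and
    the second projection is 1-Lipschitz. *)
Let le_distB f g : mdist (val f).2 (val g).2 <= dist f g.
Proof.
apply/ler_addgt0Pr => e e0; have e4 : 0 < e / 4 by rewrite divr_gt0.
have [n [fn bn]] := near_point f e4; have [m [gm bm]] := near_point g e4.
have := le_dist f g m; move: (fn m) (gm m).
rewrite !ler_distl d0 => /andP[? ?] /andP[? ?] /andP[? ?].
have := dB n m; have := metric_triangle (val f).2 (p n) (val g).2.
by have := metric_triangle (p n) (p m) (val g).2; rewrite (metric_sym (p m) (val g).2); lra.
Qed.

Let distxx f : dist f f = 0.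
Proof.
apply/eqP; rewrite eq_le dist_le ?(le_trans _ (le_dist f f 0%N)) // => i.
by rewrite subrr normr0.
Qed.

Let dist_positivity f g : dist f g = 0 -> f = g.
Proof.
move=> fg0; apply: val_inj; rewrite (surjective_pairing (val f)).
rewrite (surjective_pairing (val g)).
congr (_, _); last first.
  by apply: mdist_eq0 => e /ltW; have := le_distB f g; rewrite fg0; exact: le_trans.
apply/funext => i; apply/eqP; rewrite -subr_eq0 -normr_le0 -fg0; exact: le_dist.
Qed.

Let dist_sym f g : dist f g = dist g f.
Proof. by congr sup; apply: eq_imagel => i _; rewrite distrC. Qed.

Let dist_triangle g f h : dist f h <= dist f g + dist g h.
Proof.
apply: dist_le => i; apply: le_trans (lerD (le_dist f g i) (le_dist g h i)).
exact: ler_distD.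
Qed.

HB.instance Definition _ :=
  isMetric.Build R U distxx dist_positivity dist_sym dist_triangle.

Definition completion_map (f : U) : B := (val f).2.

Lemma completion_map_lipschitz : one_lipschitz completion_map.
Proof. exact: le_distB. Qed.

Lemma completion_point_subproof n : `[< limit_of_points (d n, p n) >].
Proof.
apply/asboolP => e e0; exists n; split=> [i|] /=; last by rewrite mdistxx ltW.
by rewrite subrr normr0 ltW.
Qed.

Definition completion_point n : U :=
  exist (fun q => `[< limit_of_points q >]) _ (completion_point_subproof n).

Lemma mdist_completion_point n m :
  mdist (completion_point n) (completion_point m) = d n m.
Proof.
apply/eqP; rewrite eq_le; apply/andP; split.
  apply: dist_le => i /=; rewrite ler_distl.
  by have := dT n m i; have := dT m n i; rewrite (dC m n); move=> *; apply/andP; split; lra.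
apply: le_trans (le_dist _ _ m) => /=; rewrite d0 subr0; exact: ler_norm.
Qed.

Lemma completion_point_dense f e : 0 < e ->
  exists n, mdist f (completion_point n) < e.
Proof.
move=> e0; have [|n [fn _]] := @near_point f (e / 2); first by rewrite divr_gt0.
exists n; apply: (@le_lt_trans _ _ (e / 2)); last lra.
exact: dist_le.
Qed.

(** The limit of a Cauchy filter is taken in each coordinate; the convergence
    is uniform by [cauchy_image_limit], so the limit is again a code. *)
Lemma completion_complete : complete_space B -> complete_space U.
Proof.
move=> cB F FF cF.
have [b bP] := cauchy_image_limit FF cB completion_map_lipschitz cF.
have /choice[l lP] : forall i, exists l : R, forall A e, F A ->
    (forall x x' : U, A x -> A x' -> mdist x x' <= e) ->
    forall x, A x -> `|(val x).1 i - l| <= e.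
  move=> i; pose ev (x : U) : R^o := (val x).1 i.
  have lip_ev : one_lipschitz (Y := R^o) ev.
    by move=> f g; rewrite /mdist /= distrC; exact: le_dist.
  have [l lP] := cauchy_image_limit FF (@complete_line R) lip_ev cF.
  by exists l => A e FA Ae x Ax; rewrite distrC; exact: lP Ae _ Ax.
have lb : `[< limit_of_points (l, b) >].
  apply/asboolP => e e0; have e2 : 0 < e / 2 by rewrite divr_gt0.
  have [A FA Ae] := (cauchy_mdistP _).1 cF _ e2.
  have [f Af] := filter_ex FA; have [n [fn bn]] := near_point f e2.
  exists n; split=> [i|] /=.
    move: (lP i A _ FA Ae f Af) (fn i); rewrite !ler_distl.
    by move=> /andP[? ?] /andP[? ?]; apply/andP; split; lra.
  have := bP A _ FA Ae f Af; have := metric_triangle b (val f).2 (p n).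
  rewrite (metric_sym b (val f).2) /completion_map; lra.
exists (exist (fun q => `[< limit_of_points q >]) (l, b) lb : U).
apply/(cvgrPdist_lt (V := U) _ _) => e e0; have e2 : 0 < e / 2 by rewrite divr_gt0.
have [A FA Ae] := (cauchy_mdistP _).1 cF _ e2.
have lA i := lP i A _ FA Ae.
apply: filterS FA => f Af; rewrite metric_sym.
apply: (@le_lt_trans _ _ (e / 2)); last lra.
by apply: dist_le => i /=; exact: lA.
Qed.

Lemma completion_polish : complete_space B -> polish (U : metricType R).
Proof.
move=> cB; split; first exact: completion_complete.
exists (range completion_point); first exact: card_image_le.
move=> O [f Of] oO; have /nbhs_ballP[e e0 eO] := open_nbhs_nbhs (conj oO Of).
have [n fn] := completion_point_dense f e0; exists (completion_point n).
by split; [apply: eO; rewrite ballEmdist | exists n].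
Qed.

End completion.

(** * From approximate to exact one-point extensions *)

Section extension_property.
Context {R : realType} {U B : metricType R} (pi : U -> B).

(** A one-point extension problem over [b]: the new point is to be at
    distance [c.2] from [c.1]. Only the constraints of [admissible] are
    included. *)
Definition extension_data (b : B) (L : seq (U * R)) : Prop :=
  (forall c c', c \in L -> c' \in L -> mdist c.1 c'.1 <= c.2 + c'.2) /\
  (forall c, c \in L -> mdist (pi c.1) b <= c.2).

(** The lower bound compares with the shortest path through [L] rather than
    with [c.2], which [extension_data] allows to be larger than that path. *)
Definition approximate_extension : Prop :=
  forall b L e, L != [::] -> extension_data b L -> 0 < e ->
  exists u, [/\ mdist (pi u) b <= e,
    forall c, c \in L -> mdist u c.1 <= c.2 + e
  & forall c, c \in L ->
      exists2 c', c' \in L & c'.2 + mdist c'.1 c.1 <= mdist u c.1 + e].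

Hypotheses (cU : complete_space U) (lip : one_lipschitz pi).
Hypothesis (approx : approximate_extension).

(** From an approximate solution [u] of error [2^-k], the pair [(u, 2^-k)] is
    added to the problem. No shortest path becomes shorter through [u], since
    [c.2 <= mdist u c.1 + 2^-k] for [c] in [L], so solving the new problem up
    to [2^-(k+1)] gives a point near [u] whose error on [L] is [2^-(k+1)]. *)
Lemma exact_extension_nonempty b L : L != [::] -> extension_data b L ->
  (forall c c', c \in L -> c' \in L -> c.2 <= mdist c.1 c'.1 + c'.2) ->
  exists u, pi u = b /\ forall c, c \in L -> mdist u c.1 = c.2.
Proof.
move=> L0 [Lsum Lb] Lcons.
have h_gt0 := @halfpow_gt0 R.
have [||v vP] := sequential_choice
    (P := fun k u => mdist (pi u) b <= 2^-1 ^+ k /\ forall c, c \in L ->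
       mdist u c.1 <= c.2 + 2^-1 ^+ k /\ c.2 <= mdist u c.1 + 2^-1 ^+ k)
    (Q := fun k u u' => mdist u u' <= 2 * 2^-1 ^+ k).
- have [u [ub uL Lu]] := approx L0 (conj Lsum Lb) (h_gt0 0%N).
  exists u; split=> // c cL; split; first exact: uL.
  have [c' c'L c'u] := Lu c cL; have := Lcons c c' cL c'L.
  by rewrite (metric_sym c.1 c'.1); lra.
- move=> k u [ub uL]; have hk := h_gt0 k.
  have [//||u' [u'b u'L Lu']] := @approx b ((u, 2^-1 ^+ k) :: L) _ _ _ (h_gt0 k.+1).
    split=> [c c'|c].
      rewrite !inE => /orP[/eqP ->|cL] /orP[/eqP ->|c'L] /=.
      - by rewrite mdistxx; lra.
      - by have [] := uL c' c'L; lra.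
      - by have [] := uL c cL; rewrite metric_sym; lra.
      - exact: Lsum.
    by rewrite inE => /orP[/eqP ->|/Lb].
  exists u'; last first.
    have := u'L (u, 2^-1 ^+ k) (mem_head _ _); rewrite metric_sym exprS /=; lra.
  split=> // c cL; have cL' : c \in (u, 2^-1 ^+ k) :: L by rewrite inE cL orbT.
  split; first exact: u'L.
  have [c'] := Lu' c cL'; rewrite inE => /orP[/eqP -> /=|c'L].
    by have [] := uL c cL; lra.
  by have := Lcons c c' cL c'L; rewrite (metric_sym c.1 c'.1); lra.
have [|u uP] := @complete_space_halfpow _ _ v cU; first by move=> k; case: (vP k).
exists u; split.
  apply: mdist_eq0 => e e0; have [|k ke] := @halfpow_small _ (e / 5).
    by rewrite divr_gt0.
  have [[vb _] _] := vP k; have := uP k; have := lip u (v k).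
  by have := metric_triangle (pi u) (pi (v k)) b; rewrite (metric_sym u (v k)); lra.
move=> c cL; apply/eqP; rewrite eq_le.
apply/andP; split; apply/ler_addgt0Pr => e e0;
  have [|k ke] := @halfpow_small _ (e / 5); rewrite ?divr_gt0 //;
  have [[_ /(_ c cL)[vc cv]] _] := vP k; have := uP k;
  have := metric_triangle u (v k) c.1; have := metric_triangle (v k) u c.1;
  rewrite (metric_sym u (v k)); lra.
Qed.

Lemma exact_extension (u0 : U) b L : extension_data b L ->
  (forall c c', c \in L -> c' \in L -> c.2 <= mdist c.1 c'.1 + c'.2) ->
  exists u, pi u = b /\ forall c, c \in L -> mdist u c.1 = c.2.
Proof.
(* The empty problem only prescribes the image b; a harmless distance to u0
   makes it nonempty. *)
have [->{L} _ _|] := eqVneq L [::]; last exact: exact_extension_nonempty.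
have [||c c'|u [ub _]] := @exact_extension_nonempty b [:: (u0, mdist (pi u0) b)].
- by [].
- split=> [c c'|c]; rewrite !inE => /eqP -> //= /eqP ->.
  by rewrite mdistxx addr_ge0 // mdist_ge0.
- by rewrite !inE => /eqP -> /eqP ->; rewrite mdistxx add0r.
- by exists u.
Qed.

Lemma exact_extension_urysohn (u0 : U) : polish U -> polish B ->
  urysohn_field pi.
Proof.
move=> pU pB; split=> // A /finite_seqP[w AE] E j t [iso_j jt] phi lip_phi phij.
have jE a a' : mdist (j a) (j a') = mdist (val a) (val a') := iso_j a a'.
(* The problem is stated with pairs in U * R, so the distances to the new point
   are first made a function on all of U. *)
have [r rP] : exists r : U -> R, forall a : A, r (val a) = mdist (j a) t.
  have /choice[r rP] : forall x : U, exists r : R,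
      forall a : A, val a = x -> r = mdist (j a) t.
    move=> x; have [Ax|nAx] := pselect (A x).
      exists (mdist (j (SigSub (mem_set Ax))) t) => a ax; congr (mdist (j _) t).
      exact/val_inj.
    by exists 0 => a ax; case: nAx; rewrite -ax; exact: set_mem (valP a).
  by exists r => a; exact: rP.
pose L := [seq (x, r x) | x <- w].
have LP c : c \in L -> exists a : A, c = (val a, mdist (j a) t).
  move=> /mapP[x xw ->]; have Ax : A x by rewrite AE.
  by exists (SigSub (mem_set Ax)); rewrite -rP.
have phijE a : phi (j a) = pi (val a) := phij a.
have [||u [uphi uL]] := @exact_extension u0 (phi t) L.
- split=> [c c' /LP[a ->] /LP[a' ->]|c /LP[a ->]] /=.
    by rewrite -jE (metric_sym (j a')); exact: metric_triangle.
  by rewrite -phijE; exact: lip_phi.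
- move=> c c' /LP[a ->] /LP[a' ->] /=.
  by rewrite -jE; exact: metric_triangle.
have ua (a : A) : mdist u (val a) = mdist t (j a).
  have aL : (val a, r (val a)) \in L.
    apply: (map_f (fun x => (x, r x))).
    by move: (val a) (set_mem (valP a)) => x; rewrite AE.
  by rewrite (uL _ aL) /= rP metric_sym.
have jNt a : j a <> t.
  by move=> jat; have : (~` range j) t; [rewrite jt | apply; exists a].
have EP y : y = t \/ exists a, y = j a.
  have [[a _ <-]|] := pselect (range j y); first by right; exists a.
  by rewrite -[~ _]/((~` range j) y) jt; left.
have /choice[i iP] : forall y, exists x, (y = t -> x = u) /\
    forall a, y = j a -> x = val a.
  move=> y; have [->|[a ->]] := EP y.
    by exists u; split=> // a /esym/jNt.
  exists (val a); split=> [/jNt //|a' jaa']; congr val.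
  by apply/val_inj/mdist_positivity; rewrite -jE jaa' mdistxx.
have it : i t = u by have [->] := iP t.
have ij a : i (j a) = val a by have [_ /(_ a)] := iP (j a); exact.
exists i; split=> // [y y'|y] /=.
- have [->|[a ->]] := EP y; have [->|[a' ->]] := EP y'; rewrite ?it ?ij ?mdistxx //.
    by rewrite metric_sym ua metric_sym.
- by have [->|[a ->]] := EP y; rewrite ?it ?ij // phijE.
Qed.

End extension_property.

(** * Existence *)

Section construction.
Context {R : realType} {B : metricType R} (D : nat -> B).
Hypothesis denseD : forall b (e : R), 0 < e -> exists k, mdist b (D k) < e.
Hypothesis polishB : polish B.

(** A request together with the index of the prescribed image. The first
    entry of the decoded list is a free parameter, whose variation makes every
    request recur. *)
Definition code (n : nat) : seq (nat * rat) * nat :=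
  if CodeSeq.decode n is [:: _; k] then odflt ([::], 0%N) (unpickle k)
  else ([::], 0%N).

(** The code of a list exceeds its entries, so the dummy entry [N] pushes the
    occurrence beyond [N]. *)
Lemma code_recurs c N : exists2 n, (N <= n)%N & code n = c.
Proof.
exists (CodeSeq.code [:: N; pickle c]).
  have := CodeSeq.gtn_decode (CodeSeq.code [:: N; pickle c]).
  by rewrite CodeSeq.codeK /= => /andP[/ltnW].
by rewrite /code CodeSeq.codeK pickleK.
Qed.

Definition code_point n : B := D (code n).2.
Definition code_request n : seq (nat * R) :=
  [seq (c.1, ratr c.2) | c <- (code n).1].

(** The points of the problem are replaced by nearby points of nat, the
    distances by rationals and [b] by a nearby term of [D]. With errors of
    [a = e / 4], raising the distances by at least [2 * a] absorbs what
    this perturbation costs in the constraints, so the request is admissible;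
    it is then realized by any point that makes it late enough. *)
Lemma completion_approximate_extension d
    (dP : forall n, field_below code_point n d) :
  (forall n, admissible code_point n d (code_point n) (code_request n) ->
     realizes n d (d n) (code_request n)) ->
  approximate_extension (@completion_map R B code_point d dP).
Proof.
move=> dR b L e L0 [Lsum Lb] e0; pose a := e / 4.
have a0 : 0 < a by rewrite divr_gt0.
have eE : e = 4 * a by rewrite /a; lra.
have /choice[q qP] : forall c : completion dP * R, exists q : nat * rat,
    mdist c.1 (completion_point dP q.1) <= a /\
    (c.2 + 2 * a <= ratr q.2 <= c.2 + 3 * a).
  move=> c; have [j cj] := completion_point_dense c.1 a0.
  have [|q] := @rat_in_itvoo R (c.2 + 2 * a) (c.2 + 3 * a); first lra.
  rewrite in_itv /= => /andP[q1 q2].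
  by exists (j, q); split; [exact: ltW | rewrite !ltW].
have [k bk] := denseD b a0.
pose N := (\max_(c <- L) (q c).1)%N.+1.
have [n Nn codeE] := code_recurs (map q L, k) N.
have pn : code_point n = D k by rewrite /code_point codeE.
have reqE : code_request n = [seq ((q c).1, ratr (q c).2) | c <- L].
  by rewrite /code_request codeE -map_comp.
have ltqn c : c \in L -> ((q c).1 < n)%N.
  move=> cL; apply: leq_trans Nn; rewrite ltnS.
  exact: leq_bigmax_seq.
have dE i j : d i j = mdist (completion_point dP i) (completion_point dP j).
  by rewrite mdist_completion_point.
have piE j : completion_map (completion_point dP j) = code_point j by [].
have /dR real : admissible code_point n d (code_point n) (code_request n).
  rewrite reqE; split.
  - by case: (L) L0.
  - by move=> _ /mapP[c cL ->]; exact: ltqn.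
  - move=> _ _ /mapP[c cL ->] /mapP[c' c'L ->] /=.
    have [qc /andP[rc _]] := qP c; have [qc' /andP[rc' _]] := qP c'.
    rewrite dE; have := Lsum c c' cL c'L.
    have := metric_triangle (completion_point dP (q c).1) c.1
      (completion_point dP (q c').1).
    have := metric_triangle c.1 c'.1 (completion_point dP (q c').1).
    by rewrite (metric_sym (completion_point dP (q c).1) c.1); lra.
  - move=> _ /mapP[c cL ->] /=; have [qc /andP[rc _]] := qP c.
    rewrite -piE pn; have := Lb c cL.
    have := completion_map_lipschitz (completion_point dP (q c).1) c.1.
    have := metric_triangle (completion_map (completion_point dP (q c).1))
      (completion_map c.1) (D k).
    have := metric_triangle (completion_map c.1) b (D k).
    by rewrite (metric_sym (completion_point dP (q c).1) c.1); lra.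
exists (completion_point dP n); split.
- by rewrite piE pn metric_sym; apply: ltW; lra.
- move=> c cL; have [qc /andP[_ rc]] := qP c; have [+ _] := real _ (ltqn c cL).
  move=> /(_ ((q c).1, ratr (q c).2)); rewrite reqE map_f // => /(_ isT) /=.
  rewrite !dE mdistxx.
  have := metric_triangle (completion_point dP n) (completion_point dP (q c).1) c.1.
  by rewrite (metric_sym (completion_point dP (q c).1) c.1); lra.
- move=> c cL; have [qc _] := qP c; have [_ [q']] := real _ (ltqn c cL).
  rewrite reqE => /mapP[c' c'L ->] /=; rewrite !dE => nE; exists c' => //.
  have [qc' /andP[rc' _]] := qP c'.
  have := metric_triangle (completion_point dP n) c.1 (completion_point dP (q c).1).
  have := metric_triangle c'.1 (completion_point dP (q c').1) c.1.
  have := metric_triangle (completion_point dP (q c').1) (completion_point dP (q c).1) c.1.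
  by rewrite (metric_sym (completion_point dP (q c).1) c.1); lra.
Qed.

Lemma urysohn_field_of_dense_sequence :
  exists (U : metricType R) (pi : U -> B), urysohn_field pi.
Proof.
have [d [dP dR]] := amalgamation_sequence code_point code_request.
have [cB _] := polishB.
exists (completion dP), (@completion_map R B code_point d dP).
apply: exact_extension_urysohn => //.
- exact: completion_complete.
- exact: completion_map_lipschitz.
- exact: completion_approximate_extension.
- exact: completion_point 0%N.
- exact: completion_polish.
Qed.

End construction.

(** If [B] is empty it is a Urysohn field over itself, as no extension problem
    exists; otherwise a countable dense set is the range of a sequence. *)
Lemma urysohn_field_exists (R : realType) (B : metricType R) : polish B ->
  exists (U : metricType R) (pi : U -> B), urysohn_field pi.
Proof.
move=> pB; have [cB [S cS dS]] := pB.
have [[b0 _]|B0] := pselect (exists b : B, True); last first.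
  exists B, idfun; split; first by split.
  by move=> A _ E j s _ phi; case: B0; exists (phi s).
have /countable_injP[f injf] := cS.
have /choice[D DP] : forall n, exists b, forall b', S b' -> f b' = n -> b = b'.
  move=> n; have [[b Sb fb]|noS] := pselect (exists2 b, S b & f b = n).
    by exists b => b' Sb' fb'; apply: injf; rewrite ?inE // fb fb'.
  by exists b0 => b' Sb' fb'; case: noS; exists b'.
apply: (@urysohn_field_of_dense_sequence R B D) => // b e e0.
have [b' Sb' bb'] := dense_near b dS e0.
by exists (f b'); rewrite (DP _ b').
Qed.

Theorem theorem3p5 (R : realType) (B : metricType R) (polishB : polish B) :
  (exists (U : metricType R) (pi : U -> B), urysohn_field pi) /\
  (forall (U U' : metricType R) (pi : U -> B) (pi' : U' -> B),
     urysohn_field pi -> urysohn_field pi' ->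
     exists psi : U -> U',
       [/\ bijective psi, isometric_embedding psi & pi' \o psi =1 pi]).
Proof.
split; first exact: urysohn_field_exists.
by move=> U U' pi pi'; exact: urysohn_field_unique.
Qed.
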